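(* Let $s\ge 2$ be an integer, $r=s^{2}$, $a(n)=\lfloor n/s+s/2\rfloor$ for $n\in\mathbb{Z}$, and $S(n)=\sum_{j=0}^{r-1}a(n-j)$. For all integers $n\ge s^{2}$: (1) if $s$ is odd, then $S(n)=sn-s(s-1)/2$ and $a(S(n))=n$; (2) if $s$ is even, then $S(n)=sn-s(s-2)/2$ and $a(S(n))=n+1$. *)

(* Defs.v *)
From mathcomp Require Import all_boot all_order all_algebra.

Set Implicit Arguments.
Unset Strict Implicit.
Unset Printing Implicit Defensive.

Import Order.TTheory GRing.Theory Num.Theory.

Local Open Scope ring_scope.

Definition aseq (s : nat) (n : int) : int :=
  Num.floor (n%:~R / s%:R + s%:R / 2%:R : rat).

Definition Ssum (s : nat) (n : int) : int :=
  \sum_(j < s ^ 2) aseq s (n - j%:Z).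

(* Main.v *)
Require Import Defs.
From mathcomp Require Import all_boot all_order all_algebra.
From mathcomp Require Import zify ring lra.

(** Up to rounding, [a n] is [(n + h) %/ s] with [h = floor (s^2 / 2)], so [S n]
    is a sum of [s] blocks of [s] consecutive quotients, and each block is
    evaluated by Hermite's identity.  Doubled, the result reads
    [2 S + s^2 = 2 s n + s] for odd [s] and [2 s n + 2 s] for even [s], from
    which [a (S n)] is read off. *)

Set Implicit Arguments.
Unset Strict Implicit.
Unset Printing Implicit Defensive.

Import Order.TTheory GRing.Theory Num.Theory.

Local Open Scope ring_scope.

(** The floor bounds are multiplied by [2 * s], which clears both denominators and leaves integer
    inequalities. *)
Lemma aseq_eq (s : nat) (n z : int) : (0 < s)%N ->
  2 * s%:Z * z <= 2 * n + s%:Z ^+ 2 < 2 * s%:Z * (z + 1) -> aseq s n = z.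
Proof.
move=> s_gt0 /andP[lez ltz]; apply: floor_def.
have s_pos : 0 < s%:R :> rat by rewrite ltr0n.
have -> : n%:~R / s%:R + s%:R / 2%:R
    = (2 * n + s%:Z ^+ 2)%:~R / (2 * s%:R) :> rat.
  by rewrite rmorphD rmorphM rmorphXn /= -pmulrn; field; rewrite gt_eqF.
have d_pos : 0 < 2 * s%:R :> rat by rewrite mulr_gt0.
have dE x : x%:~R * (2 * s%:R) = (2 * s%:Z * x)%:~R :> rat.
  by rewrite !rmorphM /= -pmulrn mulrC.
by rewrite ler_pdivlMr // ltr_pdivrMr // !dE ler_int ltr_int lez.
Qed.

(** Rounding [s ^ 2 / 2] down is harmless: a remainder [t < s] satisfies [2 * t + 1 < 2 * s], so the
    lost parity bit never reaches the next multiple of [2 * s]. *)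
Lemma aseq_divz (s : nat) (n : int) : (0 < s)%N ->
  aseq s n = ((n + (s ^ 2)./2%N%:Z) %/ s%:Z)%Z.
Proof.
move=> s_gt0; apply: aseq_eq => //.
have := divz_eq (n + (s ^ 2)./2%N%:Z) s%:Z.
have := @modz_ge0 (n + (s ^ 2)./2%N%:Z) s%:Z.
have := @ltz_pmod (n + (s ^ 2)./2%N%:Z) s%:Z.
have := odd_double_half (s ^ 2).
set q := divz _ _; set t := modz _ _; set h := half _ => hE.
have -> : s%:Z ^+ 2 = (odd (s ^ 2) + h.*2)%N%:Z by rewrite hE -mulnn PoszM expr2.
nia.
Qed.

Lemma sum_ltn (t l : nat) : (\sum_(0 <= j < l) (t < j) = l.-1 - t)%N.
Proof.
elim: l => [|l IHl]; first by rewrite big_geq.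
by rewrite big_nat_recr //= IHl; lia.
Qed.

(** With [m = q * s + t], the quotient is [q] for [j <= t] and drops to [q - 1] for the [s - 1 - t]
    indices beyond [t]. *)
Lemma sum_divz_block (s : nat) (m : int) : (0 < s)%N ->
  \sum_(0 <= j < s) ((m - j%:Z) %/ s%:Z)%Z = m - s%:Z + 1.
Proof.
move=> s_gt0.
have mE := divz_eq m s%:Z.
have t_ge0 : 0 <= (m %% s%:Z)%Z by apply: modz_ge0; lia.
have t_lt : (m %% s%:Z)%Z < s%:Z by apply: ltz_pmod; lia.
move: mE t_ge0 t_lt; set q := divz _ _; case: (modz _ _) => // t mE _ t_lt.
rewrite (eq_big_nat _ _ (F2 := fun j => q - (t < j)%N%:Z)); last first.
  move=> j /andP[_ j_lt].
  have -> : m - j%:Z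
      = (q - (t < j)%N%:Z) * s%:Z + (t%:Z - j%:Z + (t < j)%N%:Z * s%:Z).
    by rewrite mE; ring.
  rewrite divzMDl ?divz_small ?addr0 //; last by lia.
  by case: (ltnP t j) => tj /=; lia.
rewrite sumrB big_const_nat iter_addr_0 subn0.
under [X in _ - X]eq_bigr do rewrite -natz.
rewrite -natr_sum sum_ltn natz mE -mulr_natr natz; nia.
Qed.

(* Doubled, to avoid the half in [k (k - 1) / 2]. *)
Lemma sum_divz_blocks (s k : nat) (m : int) : (0 < s)%N ->
  2 * \sum_(0 <= j < k * s) ((m - j%:Z) %/ s%:Z)%Z
  = 2 * k%:Z * (m - s%:Z + 1) - s%:Z * k%:Z * (k%:Z - 1).
Proof.
move=> s_gt0; elim: k => [|k IHk]; first by rewrite big_geq //; ring.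
rewrite mulSn addnC (big_cat_nat (leq0n _) (leq_addr s (k * s))) /=.
(* The last block, reindexed from [0], is a single block starting at [m - k * s]. *)
rewrite mulrDr IHk -{1}[(k * s)%N]add0n big_addn addKn.
under eq_bigr => j _ do rewrite addnC PoszD opprD addrA.
by rewrite sum_divz_block // PoszM intS; ring.
Qed.

Lemma double_Ssum (s : nat) (n : int) : (0 < s)%N ->
  2 * Ssum s n + s%:Z ^+ 2 = 2 * s%:Z * n + (if odd s then 1 else 2) * s%:Z.
Proof.
move=> s_gt0; rewrite /Ssum.
under eq_bigr => j _ do rewrite aseq_divz // addrAC.
rewrite -(big_mkord xpredT
  (fun j => ((n + (s ^ 2)./2%N%:Z - j%:Z) %/ s%:Z)%Z)).
rewrite {1}(mulnn s : (s ^ 2 = s * s)%N) sum_divz_blocks //.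
have := odd_double_half (s ^ 2); rewrite oddX /=; set h := half _ => hE.
(* [s ^ 2] has the parity of [s]. *)
have {hE} : 2 * h%:Z = s%:Z * s%:Z - (odd s : nat)%:Z by lia.
by case: (odd s) => /= hE; ring: hE.
Qed.

Theorem theorem3p9 (s : nat) (hs : (2 <= s)%N) (n : int) (hn : (s ^ 2)%N%:Z <= n) :
  (odd s ->
     (Ssum s n)%:~R = s%:R * n%:~R - s%:R * (s%:R - 1) / 2%:R :> rat
     /\ aseq s (Ssum s n) = n)
  /\
  (~~ odd s ->
     (Ssum s n)%:~R = s%:R * n%:~R - s%:R * (s%:R - 2%:R) / 2%:R :> rat
     /\ aseq s (Ssum s n) = n + 1).
Proof.
have s_gt0 : (0 < s)%N by apply: ltnW.
have SE := double_Ssum n s_gt0.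
have SQ : 2 * (Ssum s n)%:~R + s%:R ^+ 2
    = 2 * s%:R * n%:~R + (if odd s then 1 else 2) * s%:R :> rat.
  move: (congr1 (intr : int -> rat) SE).
  by rewrite !expr2; case: (odd s); rewrite !rmorphD !rmorphM /= -!pmulrn.
split=> [s_odd | /negbTE s_even].
  rewrite s_odd in SE SQ; split; first by lra.
  (* [2 * s * n + s] is the midpoint of the interval required for [n]. *)
  by apply: aseq_eq => //; rewrite SE; nia.
rewrite s_even in SE SQ; split; first by lra.
(* Here [2 * s * n + 2 * s] equals the lower bound for [n + 1], whence the shift by one. *)
by apply: aseq_eq => //; rewrite SE; nia.
Qed.
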